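(* Let $d \in \mathbb{N}$ and $k \in \{0,d\}$. Then \[ \lim_{\mathcal{H} \to \infty}\frac{\log |B(k,d,\mathcal{H})|}{\log \mathcal{H}} = d \quad\text{and}\quad \lim_{\substack{\mathcal{H} \in B(k,d)\\ \mathcal{H} \to \infty}}\frac{\log |A(k,d,\mathcal{H})|}{\log \mathcal{H}} = d^2 ,\] and in particular both limits exist. That is, $b(0,d)=b(d,d)=d$ and $a(0,d)=a(d,d)=d^2$.
   Context: $\bar{\mathbb{Q}}$ is the algebraic closure of $\mathbb{Q}$ in $\mathbb{C}$. For $\alpha\in\bar{\mathbb{Q}}$ of degree $d$, let $a_0>0$ be the leading coefficient of a minimal polynomial of $\alpha$ in $\mathbb{Z}[t]$ (irreducible in $\mathbb{Z}[t]$) and let $\alpha_1,\dots,\alpha_d$ be its conjugates (the complex zeroes of this polynomial); the absolute multiplicative Weil height is $H(\alpha)=\big(a_0\prod_{i=1}^d\max\{1,|\alpha_i|\}\big)^{1/d}$. For $d\in\mathbb{N}$, $k\in\{0,\dots,d\}$, $\mathcal{H}\in[1,\infty)$: $A(k,d,\mathcal{H})=\{\alpha\in\mathbb{C}: [\mathbb{Q}(\alpha):\mathbb{Q}]=d,\ H(\alpha)=\mathcal{H},$ and precisely $k$ conjugates of $\alpha$ lie in the open unit disk$\}$; $A(k,d)=\bigcup_{\mathcal{H}\ge1}A(k,d,\mathcal{H})$; $B(k,d)=\{H(\alpha):\alpha\in A(k,d)\}$; $B(k,d,\mathcal{H})=B(k,d)\cap[1,\mathcal{H}]$. $a(k,d)$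 denotes $\lim_{\mathcal{H}\in B(k,d),\mathcal{H}\to\infty}\log|A(k,d,\mathcal{H})|/\log\mathcal{H}$ and $b(k,d)$ denotes $\lim_{\mathcal{H}\to\infty}\log|B(k,d,\mathcal{H})|/\log\mathcal{H}$, whenever these limits exist. *)

(* Defs.v *)
From HB Require Import structures.
From mathcomp Require Import all_boot all_order all_algebra.
From mathcomp Require Import finmap.
From mathcomp Require Import boolp classical_sets cardinality.
From mathcomp Require Import reals exp.
From mathcomp Require Import complex.

Set Implicit Arguments.
Unset Strict Implicit.
Unset Printing Implicit Defensive.
Import Order.TTheory GRing.Theory Num.Theory.
Local Open Scope ring_scope.
Local Open Scope classical_set_scope.

Section Heights.
Variable R : realType.
Local Notation C := (R[i]).

Definition cabs (z : C) : R := ComplexField.Normc.normc z.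

Definition polyZC (P : {poly int}) : {poly C} := map_poly (fun c : int => c%:~R) P.

Definition alg_degree (alpha : C) (d : nat) : Prop :=
  (exists p : {poly rat}, p != 0 /\ size p = d.+1 /\ root (map_poly ratr p) alpha) /\
  (forall q : {poly rat}, q != 0 -> root (map_poly ratr q) alpha -> (d.+1 <= size q)%N).

Definition irreducibleZ (P : {poly int}) : Prop :=
  P != 0 /\ P \isn't a GRing.unit /\
  forall Q S : {poly int}, P = Q * S -> Q \is a GRing.unit \/ S \is a GRing.unit.

Definition minpolyZ (P : {poly int}) (alpha : C) : Prop :=
  irreducibleZ P /\ 0 < lead_coef P /\ root (polyZC P) alpha.

Definition conjugates (P : {poly int}) (rs : seq C) : Prop :=
  uniq rs /\ forall z : C, z \in rs <-> root (polyZC P) z.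

Definition weil_height_of (P : {poly int}) (rs : seq C) (d : nat) : R :=
  powR ((lead_coef P)%:~R * \prod_(z <- rs) Num.max 1 (cabs z)) (d%:R^-1).

Definition setA (k d : nat) (Hh : R) : set C :=
  [set alpha | alg_degree alpha d /\
     exists (P : {poly int}) (rs : seq C), minpolyZ P alpha /\ conjugates P rs /\
       weil_height_of P rs d = Hh /\
       count (fun z => cabs z < 1) rs = k].

Definition setB (k d : nat) : set R :=
  [set Hh | 1 <= Hh /\ exists alpha, setA k d Hh alpha].

Definition setBH (k d : nat) (Hh : R) : set R :=
  setB k d `&` [set x | 1 <= x <= Hh].

End Heights.

(* number of elements of a set (its cardinality when finite; these sets
   are finite by Northcott's theorem) *)
Definition ncard (T : choiceType) (S : set T) : nat := #|` fset_set S|.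

(* Main.v *)
Require Import Defs.
From HB Require Import structures.
From mathcomp Require Import all_boot all_order all_algebra separable.
From mathcomp Require Import finmap.
From mathcomp Require Import boolp classical_sets cardinality.
From mathcomp Require Import reals topology normedtype sequences exp.
From mathcomp Require Import complex zify ring lra.
Set Implicit Arguments.
Unset Strict Implicit.
Unset Printing Implicit Defensive.
Import Order.TTheory GRing.Theory Num.Theory.
Import numFieldNormedType.Exports.

(** Put [n = H(alpha)^d]. When all conjugates lie in the open unit disk, [n] is
    the leading coefficient of the minimal polynomial, and when none does, [n]
    is the absolute value of its constant coefficient; so the heights are d-th
    roots of integers.

    Upper bound: by Mahler's inequality every coefficient is at most [2^d n],
    and one coefficient is [n] or [-n], which leaves [O(n^d)] polynomials.

    Lower bound: take a prime [p] not dividing [n] and the Eisenstein polynomials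
    [n X^d + p (c_(d-1) X^(d-1) + ... + c_1 X + u)] with [0 <= c_i <= (n-1)/(dp)]
    and [u] a prime with the same bound, [u <> p] and [u] not dividing [n]. The
    leading coefficient dominates, so all roots lie in the disk, and
    [gcd (n, p u) = 1] makes the polynomial primitive. Chebyshev's bound
    [2^m <= (2m)^(pi(2m))] provides [p = O(log^2 n)] and enough values of [u] to
    get at least [n^d] polynomials up to a power of [log n]. Inverting the roots
    turns the disk case into the case of no conjugate in the disk. *)

(** * Chebyshev's lower bound *)

Definition primes_upto (y : nat) : seq nat := [seq q <- iota 0 y.+1 | prime q].

Lemma mem_primes_upto y q : (q \in primes_upto y) = prime q && (q <= y).
Proof. by rewrite mem_filter mem_iota /= add0n ltnS. Qed.

Lemma uniq_primes_upto y : uniq (primes_upto y).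
Proof. exact/filter_uniq/iota_uniq. Qed.

Lemma leq_prod_expn (s : seq nat) (F : nat -> nat) c :
  {in s, forall q, F q <= c} -> \prod_(q <- s) F q <= c ^ size s.
Proof.
elim: s => [|a s IHs] H; first by rewrite big_nil.
rewrite big_cons expnS leq_mul ?H ?mem_head// IHs// => q qs.
by apply: H; rewrite inE qs orbT.
Qed.

Lemma leq_expn_prod (s : seq nat) (F : nat -> nat) c :
  {in s, forall q, c <= F q} -> c ^ size s <= \prod_(q <- s) F q.
Proof.
elim: s => [|a s IHs] H; first by rewrite big_nil.
rewrite big_cons expnS leq_mul ?H ?mem_head// IHs// => q qs.
by apply: H; rewrite inE qs orbT.
Qed.

Lemma prod_primes n : 0 < n -> n = \prod_(q <- primes n) q ^ logn q n.
Proof.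
by move=> n0; rewrite {1}(prod_prime_decomp n0) prime_decompE big_map.
Qed.

Lemma expn2_size_primes n : 0 < n -> 2 ^ size (primes n) <= n.
Proof.
move=> n0; rewrite {2}(prod_primes n0); apply: leq_expn_prod => q.
rewrite mem_primes => /and3P[qp _ qn].
apply: leq_trans (prime_gt1 qp) _.
by rewrite -{1}(expn1 q) leq_exp2l ?prime_gt1// -pfactor_dvdn ?expn1.
Qed.

Lemma prime_dvd_fact q n : prime q -> q %| n`! -> q <= n.
Proof.
move=> qp; elim: n => [|n IH]; first by rewrite Euclid_dvd1.
by rewrite factS Euclid_dvdM// => /orP[/dvdn_leq->//|/IH/leqW].
Qed.

Lemma expn2_bin m : 2 ^ m <= 'C(m.*2, m).
Proof.
elim: m => // m IHm; rewrite doubleS.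
(* Successive central binomials have ratio [2 (2m+1) / (m+1)], which is at least 2. *)
have E : m.+1 * 'C(m.*2.+2, m.+1) = (m.*2.+1 * 'C(m.*2, m)).*2.
  have /= E1 := mul_bin_diag m.*2.+2 m.
  have /= E2 := mul_bin_down m.*2.+1 m.
  move: E2; have -> : m.*2.+1 - m = m.+1 by lia.
  by nia.
rewrite expnS; nia.
Qed.

(* Legendre's formula: each summand [2m/p^k - 2(m/p^k)] is at most 1, and it
   vanishes once [p^k > 2m]. *)
Lemma logn_central_bin p m : prime p -> p ^ logn p 'C(m.*2, m) <= maxn 1 m.*2.
Proof.
move=> pp; have p1 := prime_gt1 pp.
case: (posnP m) => [->|m0]; first by rewrite bin0 logn1.
have -> : maxn 1 m.*2 = m.*2 by lia.
suff H : logn p 'C(m.*2, m) <= trunc_log p m.*2.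
  apply: leq_trans (trunc_logP p1 _); first by rewrite leq_exp2l.
  by rewrite double_gt0.
have E : logn p 'C(m.*2, m) + (logn p m`! + logn p m`!) = logn p (m.*2)`!.
  have <- := @bin_fact m.*2 m _; last by lia.
  have -> : m.*2 - m = m by lia.
  by rewrite !lognM ?muln_gt0 ?fact_gt0// bin_gt0; lia.
have Em : logn p m`! = \sum_(1 <= k < m.*2.+1) m %/ p ^ k.
  rewrite logn_fact// (@big_cat_nat _ _ _ m.+1 1 m.*2.+1)//=; last by lia.
  rewrite [X in _ = _ + X]big_nat_cond [X in _ = _ + X]big1 ?addn0// => i /andP[/andP[mi _] _].
  by rewrite divn_small// (ltn_trans _ (ltn_expl i p1)).
have {E} : logn p 'C(m.*2, m) <= \sum_(1 <= k < m.*2.+1) (p ^ k <= m.*2).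
  rewrite -(leq_add2r (logn p m`! + logn p m`!)) E Em logn_fact// -!big_split /=.
  apply: leq_sum => k _; rewrite -{1}addnn divnD ?expn_gt0 ?prime_gt0//.
  rewrite addnC leq_add2r -addnn.
  case: (leqP (p ^ k) (m + m)) => [_|h]; first exact: leq_b1.
  by rewrite leqn0 eqb0 -ltnNge; have := leq_mod m (p ^ k); lia.
move=> /leq_trans; apply.
rewrite (eq_bigr (fun k => if p ^ k <= m.*2 then 1 else 0)); last first.
  by move=> k _; case: leqP.
rewrite -big_mkcond /= sum1_count.
apply: leq_trans (_ : size (iota 1 (trunc_log p m.*2)) <= _); last by rewrite size_iota.
rewrite -size_filter; apply: uniq_leq_size; first exact/filter_uniq/iota_uniq.
move=> k; rewrite mem_filter !mem_iota => /andP[pk /andP[k1 _]].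
by rewrite k1 add1n ltnS trunc_log_max.
Qed.

(** The central binomial is a product of prime powers, each at most [2m] and each over a prime up to
    [2m]. *)
Lemma chebyshev_lower m : 2 ^ m <= (maxn 1 m.*2) ^ size (primes_upto m.*2).
Proof.
apply: leq_trans (expn2_bin m) _.
set b := 'C(_, _); have b0 : 0 < b by rewrite bin_gt0; lia.
rewrite {1}(prod_primes b0).
apply: leq_trans (_ : (maxn 1 m.*2) ^ size (primes b) <= _).
  apply: leq_prod_expn => q; rewrite mem_primes => /and3P[qp _ _].
  exact: logn_central_bin.
rewrite leq_pexp2l ?leq_max//; apply: uniq_leq_size; first exact: primes_uniq.
move=> q; rewrite mem_primes mem_primes_upto => /and3P[qp _ qb].
rewrite qp /=.
have : q %| (m.*2)`!.
  by rewrite -(@bin_fact m.*2 m); [apply: dvdn_mulr|lia].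
exact: prime_dvd_fact.
Qed.

(** * Primes avoiding the divisors of a given integer *)

Lemma size_primes_lt L n : 0 < n -> n < 2 ^ L -> size (primes n) < L.
Proof.
move=> n0 nL; rewrite -(@ltn_exp2l 2)//.
exact: leq_ltn_trans (expn2_size_primes n0) nL.
Qed.

Lemma size_primes_upto_ge L y : 1 < y -> y <= 2 ^ L ->
  y./2 <= L * size (primes_upto y).
Proof.
move=> y1 yL; rewrite -(@leq_exp2l 2)//.
apply: leq_trans (chebyshev_lower _) _.
have h : y./2.*2 <= y by rewrite -[leqRHS]odd_double_half leq_addl.
rewrite expnM; apply: leq_trans (_ : (2 ^ L) ^ size (primes_upto y./2.*2) <= _).
  have -> : maxn 1 y./2.*2 = y./2.*2 by lia.
  have [->//|s0] := posnP (size (primes_upto y./2.*2)).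
  by rewrite leq_exp2r//; exact: leq_trans h yL.
rewrite leq_pexp2l ?expn_gt0//; apply: uniq_leq_size (uniq_primes_upto _) _.
by move=> q; rewrite !mem_primes_upto => /andP[-> qy]; exact: leq_trans qy h.
Qed.

Lemma filter_notin_size (s t : seq nat) : uniq s ->
  size s <= size [seq q <- s | q \notin t] + size t.
Proof.
move=> us; rewrite -(count_predC (mem t) s) addnC -!size_filter leq_add2l.
apply: uniq_leq_size; first exact: filter_uniq.
by move=> q; rewrite mem_filter => /andP[].
Qed.

(** Chebyshev's bound yields at least [L] primes up to [2 * L ^ 2], while [n < 2 ^ L] has fewer than
    [L] prime divisors. From [L = 7] on, [2 * L ^ 2 <= 2 ^ L]. *)
Lemma small_nondivisor_prime L n : 7 <= L -> 0 < n -> n < 2 ^ L ->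
  exists p, [/\ prime p, ~~ (p %| n) & p <= 2 * L ^ 2].
Proof.
move=> L7 n0 nL.
have y2 : 2 * L ^ 2 <= 2 ^ L.
  elim: L L7 {nL} => // L IH; rewrite leq_eqVlt => /orP[/eqP<-//|].
  by rewrite ltnS => /[dup] L7 /IH; rewrite [2 ^ L.+1]expnS; nia.
have := size_primes_upto_ge (_ : 1 < 2 * L ^ 2) y2 => /(_ ltac:(nia)).
have -> : (2 * L ^ 2)./2 = L * L by lia.
rewrite leq_pmul2l; last by lia.
move=> h; have := filter_notin_size (primes n) (uniq_primes_upto (2 * L ^ 2)).
have := size_primes_lt n0 nL; set s := seq.filter _ _.
case: {-1}s (erefl s) => [|p s' sE _ _] /=; first by lia.
have : p \in s by rewrite sE mem_head.
rewrite mem_filter mem_primes n0 mem_primes_upto => /and3P[pn pp py].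
by exists p; split=> //; move: pn; rewrite pp.
Qed.

(** Candidates [u] for the constant coefficient [p u]: [u <> p] keeps [p ^ 2] from dividing it, and
    the second exclusion keeps [u] coprime to the leading coefficient [n]. *)
Definition good_primes (n p X : nat) : seq nat :=
  [seq u <- primes_upto X | u \notin p :: primes n].

Lemma mem_good_primes n p X u : 0 < n -> u \in good_primes n p X =
  [&& prime u, u <= X, u != p & ~~ (u %| n)].
Proof.
move=> n0; rewrite mem_filter mem_primes_upto inE mem_primes n0 /= negb_or.
by case: (prime u); rewrite ?andbF//= andbC.
Qed.

Lemma poly5_leq_exp L : 32 <= L -> 16 * L ^ 5 <= 2 ^ L.-1.
Proof.
elim: L => // L IH; rewrite leq_eqVlt => /orP[/eqP<-|].
  have -> : 16 * 32 ^ 5 = 2 ^ 29.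
    by rewrite -[16]/(2 ^ 4) -[32]/(2 ^ 5) -expnM -expnD.
  by rewrite leq_exp2l.
rewrite ltnS => /[dup] L32 /IH {}IH.
have -> : 2 ^ L.+1.-1 = 2 * 2 ^ L.-1 by case: (L) L32 => // l _; rewrite -expnS.
apply: leq_trans (_ : 2 * (16 * L ^ 5) <= _); last by rewrite leq_mul2l IH.
have -> : 2 * (16 * L ^ 5) = 16 * (2 * L ^ 5) by lia.
rewrite leq_mul2l /= !expnS !expn0 !muln1.
(* [(1 + 1/L)^2 <= 9/8], so the fifth power of [1 + 1/L] is at most [(9/8)^3 < 2]. *)
have H1 : L.+1 * L.+1 * 8 <= 9 * (L * L) by nia.
have H2 : (L.+1 * L.+1) * (L.+1 * L.+1) * 64 <= 81 * ((L * L) * (L * L)).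
  by have := leq_mul H1 H1; lia.
have H3 : L.+1 * 8 <= 9 * L by lia.
by have := leq_mul H2 H3; lia.
Qed.

(** [L] is the bit length of [n], and [X] is chosen so that [d] coefficients of size at most [p X]
    sum to less than [n]. As [d * p] is at most [2 * d * L ^ 2], only powers of [L] are lost;
    Chebyshev's bound costs one more. *)
Lemma many_good_primes d L n p : 0 < d -> d <= L -> 32 <= L ->
  2 ^ L.-1 <= n -> n < 2 ^ L -> 0 < p -> p <= 2 * L ^ 2 ->
  let X := n.-1 %/ (d * p) in
  n <= (8 * d * L ^ 3) * X.+1 /\ n <= (8 * d * L ^ 3) * size (good_primes n p X).
Proof.
move=> d0 dL L32 nL1 nL p0 pL X.
have n16 := leq_trans (poly5_leq_exp L32) nL1.
have n0 : 0 < n by rewrite (leq_trans _ nL1) ?expn_gt0.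
set q := d * p in X *.
have q0 : 0 < q by rewrite muln_gt0 d0.
have qL : q <= 2 * d * L ^ 2 by rewrite /q; nia.
have nX : n <= X.+1 * q by have := ltn_ceil n.-1 q0; rewrite -/X; lia.
have L23 : L ^ 3 = L * L ^ 2 by rewrite expnS.
set M := L ^ 2 in qL L23 pL *.
have ML : M = L * L by rewrite /M expnS expn1.
split.
  apply: leq_trans nX _; rewrite mulnC leq_mul2r; apply/orP; right.
  by rewrite L23; nia.
have X1 : 1 < X.
  rewrite ltnNge; apply/negP => X1.
  have : n <= 2 * q by nia.
  move: n16 qL; rewrite !expnS expn0 muln1 ML; nia.
have XL : X <= 2 ^ L.
  by apply: leq_trans (leq_div _ _) _; lia.
have h1 := size_primes_upto_ge X1 XL.
have h2 := filter_notin_size (p :: primes n) (uniq_primes_upto X).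
have h3 := size_primes_lt n0 nL.
rewrite -/(good_primes n p X) /= in h2; set g := size (good_primes _ _ _) in h2 *.
have h4 : X <= 2 * L * (g + L) + 1.
  have : L * size (primes_upto X) <= L * (g + L) by rewrite leq_mul2l; lia.
  move: h1; have := odd_double_half X; case: (odd X); lia.
have h5 : n <= (2 * L * g + (2 * M + 2)) * q by apply: leq_trans nX _; nia.
(* The excluded primes account for at most half of [n], because [16 * L ^ 5 <= n], and are absorbed
   by doubling the main term. *)
have h6 : 2 * ((2 * M + 2) * q) <= n.
  apply: leq_trans n16.
  have : (2 * M + 2) * q <= (4 * M) * (2 * L * M).
    by apply: leq_mul; [lia | apply: leq_trans qL _; nia].
  have -> : L ^ 5 = M * M * L by rewrite /M -expnD -expnSr.
  lia.
have h7 : n <= 4 * L * g * q by lia.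
apply: leq_trans h7 _; rewrite L23.
apply: leq_trans (leq_mul (leqnn (4 * L * g)) qL) _; lia.
Qed.

Local Open Scope ring_scope.
Local Open Scope classical_set_scope.

Local Notation pZtoQ := (map_poly (intr : int -> rat)).

(** * Minimal polynomials *)

Section Degree.
Variable R : realType.
Local Notation C := (R[i]).
Implicit Types (P : {poly int}) (q : {poly rat}) (alpha z : C) (rs : seq C).

Lemma map_ratr_pZtoQ P : map_poly ratr (pZtoQ P) = polyZC R P.
Proof.
rewrite -map_poly_comp /polyZC; apply: eq_map_poly => c /=.
exact: ratr_int.
Qed.

(** By Gauss's lemma a rational divisor of [P] is a scalar multiple of an integer one, to which
    irreducibility over the integers applies. *)
Lemma irreducibleZ_dvd P q : irreducibleZ P -> q %| pZtoQ P ->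
  size q = 1%N \/ size q = size P.
Proof.
move=> [P0 [_ irrP]] /dvdpP_rat_int[q1 [a a0 ->] [r Pq]].
rewrite size_scale// size_rat_int_poly.
have r0 : r != 0 by apply: contraNneq P0 => r0; rewrite Pq r0 mulr0.
have q0 : q1 != 0 by apply: contraNneq P0 => q0; rewrite Pq q0 mul0r.
case: (irrP _ _ Pq); rewrite poly_unitE => /andP[/eqP s1 _]; first by left.
by right; rewrite Pq size_mul// s1 addn1.
Qed.

Lemma root_modp (F : fieldType) (p q : {poly F}) x :
  root p x -> root q x -> root (p %% q) x.
Proof.
move=> /rootP px /rootP qx; move: px; rewrite {1}(divp_eq p q) hornerD hornerM qx mulr0 add0r.
by move/rootP.
Qed.

Lemma alg_degree_dvd alpha d (p q : {poly rat}) : alg_degree alpha d ->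
  p != 0 -> size p = d.+1 -> root (map_poly ratr p) alpha ->
  root (map_poly ratr q) alpha -> p %| q.
Proof.
move=> [_ min] p0 sp pa qa; apply: contraT => r0.
have ra : root (map_poly ratr (q %% p)) alpha.
  by have := root_modp qa pa; rewrite -map_modp.
by have := min _ r0 ra; rewrite -sp leqNgt ltn_modp p0.
Qed.

Lemma size_minpolyZ P alpha d : (0 < d)%N -> minpolyZ P alpha ->
  alg_degree alpha d -> size P = d.+1.
Proof.
move=> d0 [irrP [_ Pa]] deg; have [[p [p0 [sp pa]]] _] := deg.
have := alg_degree_dvd deg p0 sp pa; rewrite -map_ratr_pZtoQ in Pa.
move=> /(_ _ Pa)/(irreducibleZ_dvd irrP)[|]; rewrite sp// => -[] d1.
by rewrite d1 in d0.
Qed.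

(** The gcd of [P] and its derivative is constant or has the size of [P], which is too large to
    divide the nonzero derivative. Simple roots make the duplicate-free list in [conjugates] account
    for the whole degree. *)
Lemma separable_minpolyZ P alpha d : (0 < d)%N -> minpolyZ P alpha ->
  alg_degree alpha d -> separable_poly (polyZC R P).
Proof.
move=> d0 mP deg; have sP := size_minpolyZ d0 mP deg; have [irrP _] := mP.
rewrite -map_ratr_pZtoQ separable_map separable_poly.unlock.
have P0 : pZtoQ P != 0 by rewrite -size_poly_eq0 size_rat_int_poly sP.
have dP0 : (pZtoQ P)^`() != 0.
  apply: contra_neq P0 => /(congr1 (fun p : {poly rat} => p`_d.-1)).
  rewrite coef_deriv coef0 prednK// => /eqP; rewrite mulrn_eq0 eqn0Ngt d0 /=.
  by move=> Pd; apply/eqP; rewrite -lead_coef_eq0 lead_coefE size_rat_int_poly sP.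
case: (irreducibleZ_dvd irrP (dvdp_gcdl _ (pZtoQ P)^`())) => [s1|sg].
  by rewrite /coprimep s1.
have := dvdp_leq dP0 (dvdp_gcdr (pZtoQ P) _); rewrite sg.
by have := lt_size_deriv P0; rewrite size_rat_int_poly ltnNge => /negbTE->.
Qed.

Lemma lead_coef_polyZC P : lead_coef (polyZC R P) = (lead_coef P)%:~R.
Proof.
by rewrite -map_ratr_pZtoQ lead_coef_map (lead_coef_map_inj (@intr_inj _))//= ratr_int.
Qed.

Lemma polyZC_eq0 P : (polyZC R P == 0) = (P == 0).
Proof. by rewrite -!lead_coef_eq0 lead_coef_polyZC intr_eq0. Qed.

Lemma conjugates_exist P alpha d : (0 < d)%N -> minpolyZ P alpha ->
  alg_degree alpha d -> exists rs, conjugates P rs.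
Proof.
move=> d0 mP deg; have sep := separable_minpolyZ d0 mP deg.
have [irrP [lP _]] := mP.
have [rs E] := closed_field_poly_normal (polyZC R P).
have l0 : lead_coef (polyZC R P) != 0 by rewrite lead_coef_polyZC intr_eq0 gt_eqF.
exists rs; split.
  rewrite -separable_prod_XsubC; move: sep; rewrite E separable_poly.unlock.
  by rewrite derivZ coprimepZl// coprimepZr.
by move=> z; rewrite E rootZ// root_prod_XsubC.
Qed.

Lemma conjugates_prod P alpha d rs : (0 < d)%N -> minpolyZ P alpha ->
  alg_degree alpha d -> conjugates P rs ->
  polyZC R P = (lead_coef P)%:~R *: \prod_(z <- rs) ('X - z%:P).
Proof.
move=> d0 mP deg [urs rsP]; have sep := separable_minpolyZ d0 mP deg.
have [irrP [lP _]] := mP.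
have [ss E] := closed_field_poly_normal (polyZC R P).
have l0 : lead_coef (polyZC R P) != 0 by rewrite lead_coef_polyZC intr_eq0 gt_eqF.
rewrite E lead_coef_polyZC; congr (_ *: _); apply: perm_big; apply: uniq_perm => //.
  rewrite -separable_prod_XsubC; move: sep; rewrite E separable_poly.unlock.
  by rewrite derivZ coprimepZl// coprimepZr.
move=> z; have := rsP z; rewrite E rootZ// root_prod_XsubC => h.
by apply/idP/idP => /h.
Qed.

Lemma size_conjugates P alpha d rs : (0 < d)%N -> minpolyZ P alpha ->
  alg_degree alpha d -> conjugates P rs -> size rs = d.
Proof.
move=> d0 mP deg cP; have := congr1 (fun p : {poly C} => size p) (conjugates_prod d0 mP deg cP).
have [irrP [lP _]] := mP.
rewrite size_scale ?intr_eq0 ?gt_eqF// size_prod_XsubC.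
rewrite -map_ratr_pZtoQ size_map_poly size_rat_int_poly (size_minpolyZ d0 mP deg).
by case.
Qed.

(** In a factorization, the factor vanishing at [alpha] already has full degree, so the other is a
    constant; it divides both end coefficients, which are coprime, hence is a unit. *)
Lemma minpolyZ_primitive P alpha d : (0 < d)%N -> alg_degree alpha d ->
  size P = d.+1 -> 0 < lead_coef P -> root (polyZC R P) alpha ->
  coprimez P`_0 (lead_coef P) -> minpolyZ P alpha.
Proof.
move=> d0 deg sP lP Pa cop; split=> //.
have P0 : P != 0 by rewrite -size_poly_eq0 sP.
have key (Q S : {poly int}) : P = Q * S -> root (polyZC R Q) alpha -> S \is a GRing.unit.
  move=> PQS Qa; have Q0 : Q != 0 by apply: contraNneq P0 => h; rewrite PQS h mul0r.
  have S0 : S != 0 by apply: contraNneq P0 => h; rewrite PQS h mulr0.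
  have /(_ (pZtoQ Q)) := deg.2; rewrite map_ratr_pZtoQ Qa => /(_ _ isT).
  rewrite -size_poly_eq0 size_rat_int_poly size_poly_eq0 => /(_ Q0).
  have sQS : ((size Q + size S).-1 = d.+1)%N by rewrite -size_mul// -PQS.
  have S1 : (0 < size S)%N by rewrite size_poly_gt0.
  have size1 a b : ((a + b).-1 = d.+1 -> 0 < b -> d < a -> b = 1)%N by lia.
  move=> /(size1 _ _ sQS S1) sS.
  rewrite poly_unitE sS eqxx /=.
  have /eqP/size_poly1P[c c0 Sc] := sS; rewrite Sc coefC /=.
  move: cop; rewrite PQS Sc mulrC mul_polyC lead_coefZ coefZ /coprimez => /eqP g1.
  have := dvdz_gcd c (c * Q`_0) (c * lead_coef Q); rewrite g1 !dvdz_mulr//= => /dvdzP[e ce].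
  by apply/unitrPr; exists e; rewrite mulrC.
split=> //; split.
  by rewrite poly_unitE sP; case: (d) d0.
move=> Q S PQS; have := Pa; rewrite PQS /polyZC rmorphM /= rootM => /orP[] h.
  by right; apply: key h.
by left; apply: key h; rewrite mulrC.
Qed.

(** The gcd of [P] with a rational [q] vanishing at [alpha] also vanishes there, so it is not
    constant and must be associate to [P]. *)
Lemma irreducible_alg_degree P alpha d : irreducible_poly P -> size P = d.+1 ->
  root (polyZC R P) alpha -> alg_degree alpha d.
Proof.
move=> /irreducible_rat_int[_ irrP] sP; rewrite -map_ratr_pZtoQ => Pa.
have P0 : pZtoQ P != 0 by rewrite -size_poly_eq0 size_rat_int_poly sP.
split; first by exists (pZtoQ P); rewrite size_rat_int_poly.
move=> q q0 qa; have ga : root (map_poly ratr (gcdp (pZtoQ P) q)) alpha.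
  by rewrite gcdp_map root_gcd Pa.
have /eqp_size E : gcdp (pZtoQ P) q %= pZtoQ P.
  apply: irrP (dvdp_gcdl _ _); apply: contraTneq ga => /eqP/size_poly1P[c c0 ->].
  by rewrite map_polyC rootC fmorph_eq0.
by rewrite -sP -size_rat_int_poly -E dvdp_leq ?dvdp_gcdr.
Qed.

End Degree.

(** * Reversed polynomials and inverses *)

Section Reversal.

(** The reciprocal polynomial [X^m p(1/X)]. A fixed [m] instead of the degree keeps reversal
    involutive when the constant coefficient is zero. *)
Definition revpoly (A : nzRingType) (m : nat) (p : {poly A}) : {poly A} :=
  \poly_(i < m.+1) p`_(m - i).

Lemma revpolyK (A : nzRingType) m (p : {poly A}) : (size p <= m.+1)%N ->
  revpoly m (revpoly m p) = p.
Proof.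
move=> sp; apply/polyP => i; rewrite coef_poly coef_poly !ltnS leq_subr.
case: (leqP i m) => im; first by rewrite subKn.
by rewrite nth_default// (leq_trans sp).
Qed.

Lemma size_revpoly (A : nzRingType) m (p : {poly A}) : (size (revpoly m p) <= m.+1)%N.
Proof. exact: size_poly. Qed.

Lemma revpoly_neq0 (A : nzRingType) m (p : {poly A}) : (size p <= m.+1)%N ->
  p != 0 -> revpoly m p != 0.
Proof.
move=> sp; apply: contra_neq => h; rewrite -(revpolyK sp) h.
by apply/polyP => i; rewrite coef_poly !coef0 if_same.
Qed.

Lemma map_revpoly (A B : nzRingType) (f : {rmorphism A -> B}) m (p : {poly A}) :
  map_poly f (revpoly m p) = revpoly m (map_poly f p).
Proof.
apply/polyP => i; rewrite coef_map [in LHS]coef_poly [in RHS]coef_poly coef_map.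
by case: ifP => // _; exact: raddf0.
Qed.

Lemma horner_revpoly (F : fieldType) m (p : {poly F}) x : (size p <= m.+1)%N ->
  x != 0 -> (revpoly m p).[x] = x ^+ m * p.[x^-1].
Proof.
move=> sp x0; rewrite horner_poly (horner_coef_wide _ sp) mulr_sumr.
rewrite (reindex_inj rev_ord_inj) /=; apply: eq_bigr => i _.
have im : (i <= m)%N by rewrite -ltnS.
rewrite subSS subKn// mulrCA; congr (_ * _).
by rewrite exprVn expfB_cond// (negbTE x0).
Qed.

Lemma root_revpoly (F : fieldType) m (p : {poly F}) x : (size p <= m.+1)%N ->
  x != 0 -> root (revpoly m p) x = root p x^-1.
Proof.
by move=> sp x0; rewrite /root horner_revpoly// mulf_eq0 expf_eq0 (negbTE x0) andbF.
Qed.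

End Reversal.

(** * Heights *)

Section Height.
Variable R : realType.
Local Notation C := (R[i]).
Implicit Types (P : {poly int}) (q : {poly rat}) (alpha z : C) (rs : seq C).

Lemma alg_degreeV alpha d : (0 < d)%N -> alpha != 0 -> alg_degree alpha d ->
  alg_degree alpha^-1 d.
Proof.
move=> d0 a0 [[p [p0 [sp pa]]] min].
have minV q : q != 0 -> root (map_poly ratr q) alpha^-1 -> (d.+1 <= size q)%N.
  move=> q0 qa; rewrite ltnNge; apply/negP => sq.
  have sq' : (size q <= d.-1.+1)%N by rewrite prednK.
  (* Reversing a too small polynomial that annihilates the inverse would give one that annihilates
     [alpha]. *)
  have := min (revpoly d.-1 q) (revpoly_neq0 sq' q0).
  rewrite map_revpoly root_revpoly ?size_map_poly// => /(_ qa).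
  by rewrite ltnNge (leq_trans (size_revpoly _ _))// prednK.
split=> //; have sp' : (size p <= d.+1)%N by rewrite sp.
have ra : root (map_poly ratr (revpoly d p)) alpha^-1.
  by rewrite map_revpoly root_revpoly ?size_map_poly ?invr_eq0 ?invrK.
have r0 := revpoly_neq0 sp' p0; exists (revpoly d p); split=> //; split=> //.
by apply/eqP; rewrite eqn_leq size_revpoly minV.
Qed.

Lemma normC_cabs z : `|z| = (cabs z)%:C%C.
Proof. by case: z. Qed.

Lemma cabs_ge0 z : 0 <= cabs z.
Proof. by case: z => a b; rewrite /cabs /= sqrtr_ge0. Qed.

Lemma cabs_int (m : int) : cabs (m%:~R : C) = `|m|%:~R.
Proof.
have : `|m%:~R : C| = (`|m|%:~R)%:C%C by rewrite -intr_norm rmorph_int.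
by rewrite normC_cabs => /(@complexI R).
Qed.

Lemma cabsM z w : cabs (z * w) = cabs z * cabs w.
Proof. exact: ComplexField.Normc.normcM. Qed.

Lemma cabs_prod rs : cabs (\prod_(z <- rs) z) = \prod_(z <- rs) cabs z.
Proof.
elim: rs => [|z rs IH]; first by rewrite !big_nil (cabs_int 1).
by rewrite !big_cons cabsM IH.
Qed.

Lemma cabsN z : cabs (- z) = cabs z.
Proof. by apply: (@complexI R); rewrite -!normC_cabs normrN. Qed.

Lemma cabsB_le z w : cabs (z - w) <= cabs z + cabs w.
Proof. by rewrite -lecR rmorphD /= -!normC_cabs ler_normB. Qed.

(** Multiplying by [X - z] turns coefficients into [c_(i-1) - z c_i], so the bound grows by the
    factor [1 + cabs z]. *)
Lemma coef_prod_XsubC_le rs i :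
  cabs (\prod_(z <- rs) ('X - z%:P))`_i <= \prod_(z <- rs) (1 + cabs z).
Proof.
elim: rs i => [|z rs IH] i.
  rewrite !big_nil coef1 (_ : (_%:R : C) = ((i == 0)%N : int)%:~R) ?cabs_int//.
  by case: eqP => // _; rewrite normr0.
rewrite !big_cons mulrBl coefB coefXM coefCM.
apply: le_trans (cabsB_le _ _) _; rewrite cabsM mulrDl mul1r lerD//; last first.
  by rewrite ler_wpM2l ?cabs_ge0.
case: eqP => // _; rewrite (cabs_int 0) normr0.
by apply: prodr_ge0 => w _; rewrite addr_ge0 ?cabs_ge0.
Qed.

(** The Mahler measure of [P] when [rs] lists its roots; the height is its [d]-th root. *)
Definition mahler P rs : R := (lead_coef P)%:~R * \prod_(z <- rs) Num.max 1 (cabs z).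

(** Mahler's inequality, from [1 + cabs z <= 2 max(1, cabs z)] at each root. *)
Lemma coef_le_mahler P rs i : 0 < lead_coef P ->
  polyZC R P = (lead_coef P)%:~R *: \prod_(z <- rs) ('X - z%:P) ->
  `|P`_i|%:~R <= 2 ^+ size rs * mahler P rs.
Proof.
move=> lP E; rewrite -cabs_int.
have -> : (P`_i)%:~R = (polyZC R P)`_i by rewrite coef_map_id0.
rewrite E coefZ cabsM cabs_int gtr0_norm// /mahler mulrCA ler_wpM2l ?ler0z ?(ltW lP)//.
apply: le_trans (coef_prod_XsubC_le _ _) _.
elim: (rs) => [|z s IH]; first by rewrite !big_nil expr0 mul1r.
rewrite !big_cons /= exprS mulrACA ler_pM//.
- by rewrite addr_ge0 ?cabs_ge0.
- by apply: prodr_ge0 => w _; rewrite addr_ge0 ?cabs_ge0.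
by rewrite mulr2n mulrDl mul1r lerD// le_max lexx ?orbT.
Qed.

Lemma mahler_disk P rs : all (fun z => cabs z < 1) rs ->
  mahler P rs = (lead_coef P)%:~R.
Proof.
move=> /allP h; rewrite /mahler big_seq big1 ?mulr1// => z /h z1.
by rewrite max_l// ltW.
Qed.

(** By Vieta the constant coefficient is, up to sign, the leading one times the product of the
    roots, and here every maximum equals [cabs z]. *)
Lemma mahler_codisk P rs : 0 < lead_coef P ->
  polyZC R P = (lead_coef P)%:~R *: \prod_(z <- rs) ('X - z%:P) ->
  all (fun z => 1 <= cabs z) rs -> mahler P rs = `|P`_0|%:~R.
Proof.
move=> lP E /allP h; rewrite -cabs_int.
have -> : (P`_0)%:~R = (polyZC R P)`_0 by rewrite coef_map_id0.
rewrite E coefZ cabsM cabs_int gtr0_norm// /mahler; congr (_ * _).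
rewrite -horner_coef0 horner_prod.
rewrite (eq_bigr (fun z => - z)); last by move=> z _; rewrite !hornerE ?sub0r.
rewrite -(big_map -%R xpredT id) cabs_prod big_map.
apply: eq_big_seq => z /h z1.
by rewrite cabsN max_r.
Qed.

Lemma weil_height_mahler P rs d : weil_height_of P rs d = powR (mahler P rs) d%:R^-1.
Proof. by []. Qed.

Lemma powR_exprn d (x : R) : (0 < d)%N -> 0 <= x -> powR x d%:R^-1 ^+ d = x.
Proof.
move=> d0 x0; rewrite -powR_mulrn ?powR_ge0// -powRrM mulVf ?powRr1//.
by rewrite pnatr_eq0 -lt0n.
Qed.

Lemma exprn_powR d (x : R) : (0 < d)%N -> 0 <= x -> powR (x ^+ d) d%:R^-1 = x.
Proof.
move=> d0 x0; rewrite -powR_mulrn// -powRrM mulfV ?powRr1//.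
by rewrite pnatr_eq0 -lt0n.
Qed.

Lemma mahler_ge0 P rs : 0 < lead_coef P -> 0 <= mahler P rs.
Proof.
move=> lP; rewrite mulr_ge0 ?ler0z ?(ltW lP)// prodr_ge0// => z _.
by rewrite le_max ler01.
Qed.

(** The index [k] itself selects the coefficient carrying the height: the constant one for [k = 0],
    the leading one for [k = d]. *)
Lemma setA_coef k d Hh alpha : (0 < d)%N -> (k = 0 \/ k = d)%N ->
  setA k d Hh alpha ->
  exists P, [/\ size P = d.+1, root (polyZC R P) alpha,
    `|P`_k|%:~R = Hh ^+ d & forall i, `|P`_i|%:~R <= 2 ^+ d * Hh ^+ d].
Proof.
move=> d0 hk [deg [P [rs [mP [cP [hH hc]]]]]].
have sP := size_minpolyZ d0 mP deg; have E := conjugates_prod d0 mP deg cP.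
have srs := size_conjugates d0 mP deg cP; have [_ [lP Pa]] := mP.
have HE : Hh ^+ d = mahler P rs by rewrite -hH powR_exprn ?mahler_ge0.
exists P; rewrite HE; split=> //; last first.
  by move=> i; rewrite -[X in _ ^+ X]srs; exact: coef_le_mahler.
case: hk => hk.
  have h : all (fun z => 1 <= cabs z) rs.
    rewrite (eq_all (a2 := predC (fun z => cabs z < 1))).
      by rewrite all_predC has_count hc hk.
    by move=> z /=; rewrite -leNgt.
  by rewrite (mahler_codisk lP E h) hk.
have h : all (fun z => cabs z < 1) rs by rewrite all_count hc hk srs.
have lE : lead_coef P = P`_d by rewrite lead_coefE sP.
by rewrite mahler_disk// hk -lE gtr0_norm.
Qed.

Lemma setB_nat k d Hh : (0 < d)%N -> (k = 0 \/ k = d)%N -> setB k d Hh ->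
  exists n : nat, Hh ^+ d = n%:R :> R.
Proof.
move=> d0 hk [_ [alpha /(setA_coef d0 hk)[P [_ _ h _]]]].
by exists (absz P`_k); rewrite -h -abszE.
Qed.

End Height.

Lemma ncard_le_seq (T : choiceType) (A : set T) (s : seq T) :
  A `<=` [set` s] -> finite_set A /\ (ncard A <= size s)%N.
Proof.
move=> As; have fA : finite_set A := sub_finite_set As (finite_seq s).
split=> //; rewrite /ncard cardfE; apply: leq_trans (_ : (size (enum_fset (fset_set A)) <= _)%N).
  by rewrite -cardfE.
apply: uniq_leq_size; first exact: fset_uniq.
by move=> x; rewrite in_fset_set// inE => /As.
Qed.

Lemma ncard_ge_inj (T : choiceType) (A : set T) (I : finType) (D : {pred I})
    (g : I -> T) : finite_set A -> {in D &, injective g} ->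
  (forall i, i \in D -> A (g i)) -> (#|D| <= ncard A)%N.
Proof.
move=> fA inj DA; rewrite cardE -(size_map g); apply: uniq_leq_size.
  by rewrite map_inj_in_uniq ?enum_uniq// => x y; rewrite !mem_enum; exact: inj.
move=> y /mapP[x]; rewrite mem_enum => xD ->.
by rewrite in_fset_set// inE; exact: DA.
Qed.

(** * Counting *)

Section Upper.
Variable R : realType.
Local Notation C := (R[i]).
Implicit Types (P : {poly int}) (alpha : C).

(** Coefficient [j] is [n] up to the sign coded by [x.1]; the others lie between [-N] and [N] and
    are stored shifted by [N]. There are [2 (2N+1)^d] codes. *)
Definition box_poly d (j : 'I_d.+1) (n N : nat) (x : bool * {ffun 'I_d -> 'I_(2 * N).+1})
  : {poly int} :=
  \poly_(i < d.+1) if unlift j (inord i) is Some i' then (x.2 i')%:Z - N%:Z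
                   else (-1) ^+ x.1 * n%:Z.

Lemma box_poly_onto d (j : 'I_d.+1) (n N : nat) P : size P = d.+1 ->
  `|P`_j| = n%:Z -> (forall i, `|P`_i| <= N%:Z) ->
  exists x, P = box_poly j n (N := N) x.
Proof.
move=> sP Pj PN.
exists ((P`_j < 0), [ffun i' : 'I_d => inord (absz (P`_(lift j i') + N%:Z))]).
apply/polyP => i; rewrite coef_poly; case: ltnP => id; last by rewrite nth_default ?sP.
case: unliftP => [i' ij|ij]; last first.
  by rewrite -[i in LHS](inordK id) ij /fst -Pj mulr_sign_norm.
rewrite /snd ffunE -ij inordK//; have := PN i => PNi.
  by rewrite inordK; lia.
by rewrite inordK; lia.
Qed.

Definition roots_of (p : {poly C}) : seq C := sval (closed_field_poly_normal p).

Lemma roots_ofP (p : {poly C}) x : p != 0 -> root p x -> x \in roots_of p.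
Proof.
move=> p0; rewrite /roots_of; case: closed_field_poly_normal => rs /= E.
by rewrite {1}E rootZ ?lead_coef_eq0// root_prod_XsubC.
Qed.

Lemma size_roots_of (p : {poly C}) d : (0 < d)%N -> (size p <= d.+1)%N ->
  (size (roots_of p) <= d)%N \/ p = 0.
Proof.
move=> d0; have [->|p0] := eqVneq p 0; first by right.
move=> sp; left; move: sp; rewrite /roots_of.
case: closed_field_poly_normal => rs /= E.
by rewrite {1}E size_scale ?lead_coef_eq0// size_prod_XsubC.
Qed.

Lemma setA_upper k d (n : nat) Hh : (0 < d)%N -> (k = 0 \/ k = d)%N ->
  Hh ^+ d = n%:R :> R ->
  finite_set (setA k d Hh) /\
  (ncard (setA k d Hh) <= d * (2 * (2 * (2 ^ d * n)).+1 ^ d))%N.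
Proof.
move=> d0 hk Hn; set N := (2 ^ d * n)%N.
have kd : (k < d.+1)%N by case: hk => ->.
pose bp := @box_poly d (Ordinal kd) n N.
(* [roots_of] has no length bound for the zero polynomial, which arises when [n = 0]; [take d] makes
   the bound uniform. *)
pose rts x := take d (roots_of (polyZC R (bp x))).
have [|fA cA] := @ncard_le_seq _ (setA k d Hh)
  (flatten [seq rts x | x <- enum {: bool * {ffun 'I_d -> 'I_(2 * N).+1}}]).
  move=> alpha /(setA_coef d0 hk)[P [sP Pa Pk PN]] /=.
  have [||x Px] := @box_poly_onto d (Ordinal kd) n N P sP.
  - by apply/eqP; rewrite -(eqr_int R) /= Pk Hn.
  - by move=> i; rewrite -(ler_int R); apply: le_trans (PN i) _; rewrite Hn /N -pmulrn natrM natrX.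
  apply/flattenP; exists (rts x); first by apply: map_f; rewrite mem_enum.
  rewrite /rts /bp -Px; have P0 : polyZC R P != 0.
    by rewrite polyZC_eq0 -size_poly_eq0 sP.
  rewrite take_oversize; first exact: roots_ofP.
  case: (size_roots_of d0 (_ : (size (polyZC R P) <= d.+1)%N)) => //.
    by rewrite -map_ratr_pZtoQ size_map_poly size_rat_int_poly sP.
  by move=> h; rewrite h eqxx in P0.
split=> //; apply: leq_trans cA _.
rewrite size_flatten /shape -map_comp.
apply: leq_trans (_ : (sumn (nseq (size (enum {: bool * {ffun 'I_d -> 'I_(2 * N).+1}})) d) <= _)%N).
  elim: (enum _) => //= x s IH; rewrite leq_add//.
  by rewrite size_take_min geq_minl.
by rewrite sumn_nseq -cardE card_prod card_bool card_ffun !card_ord mulnC.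
Qed.

End Upper.

(** * Lower bound for the number of points of a given height *)

Section Lower.
Variable R : realType.
Local Notation C := (R[i]).
Implicit Types (P : {poly int}) (alpha z : C) (a : nat -> nat).

(** If [1 <= cabs z], no lower power of [z] exceeds the top one in modulus, so the lower terms are
    too small to cancel the leading term. *)
Lemma dominant_lead_disk a d z : (0 < d)%N -> (\sum_(i < d) a i < a d)%N ->
  root (polyZC R (\poly_(i < d.+1) (a i)%:Z)) z -> cabs z < 1.
Proof.
move=> d0 ha /rootP; rewrite (horner_coef_wide _ (n := d.+1)); last first.
  by rewrite (leq_trans (size_poly _ _))// size_poly.
rewrite big_ord_recr /= coef_map_id0// coef_poly ltnSn => E.
rewrite ltNge; apply/negP; rewrite -lecR -normC_cabs => z1.
have z0 : 0 < `|z| ^+ d by rewrite exprn_gt0// (lt_le_trans ltr01).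
have : `|\sum_(i < d) (polyZC R (\poly_(i < d.+1) (a i)%:Z))`_i * z ^+ i| =
    (a d)%:R * `|z| ^+ d.
  by move/eqP: E; rewrite addr_eq0 => /eqP ->; rewrite normrN normrM normrX normr_nat.
apply/eqP; rewrite lt_eqF//.
apply: le_lt_trans (ler_norm_sum _ _ _) _.
apply: le_lt_trans (_ : _ <= (\sum_(i < d) a i)%:R * `|z| ^+ d) _; last first.
  by rewrite ltr_pM2r// ltr_nat.
rewrite natr_sum mulr_suml; apply: ler_sum => i _.
rewrite normrM normrX coef_map_id0// coef_poly ltnS (ltnW (ltn_ord i)) normr_nat.
by rewrite ler_wpM2l// ler_weXn2l// ltnW.
Qed.

Lemma size_poly_lead a d : (0 < a d)%N ->
  size (\poly_(i < d.+1) (a i)%:Z) = d.+1.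
Proof. by move=> ad; rewrite size_poly_eq//= -lt0n. Qed.

Lemma revpoly_poly a d :
  revpoly d (\poly_(i < d.+1) (a i)%:Z) = \poly_(i < d.+1) (a (d - i)%N)%:Z.
Proof.
by apply/polyP => i; rewrite [LHS]coef_poly [RHS]coef_poly coef_poly !ltnS leq_subr.
Qed.

(** * Eisenstein polynomials with a dominant leading coefficient *)

Section Eisenstein.
Variables (a : nat -> nat) (d p : nat) (alpha : C).
Hypotheses (d0 : (0 < d)%N) (pp : prime p) (pd : ~~ (p %| a d)%N)
  (pa : forall i, (i < d)%N -> (p %| a i)%N) (pa0 : ~~ (p ^ 2 %| a 0)%N)
  (cop : coprime (a 0) (a d)) (dom : (\sum_(i < d) a i < a d)%N).

Let P := \poly_(i < d.+1) (a i)%:Z.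
Hypothesis Pa : root (polyZC R P) alpha.

Let ad0 : (0 < a d)%N. Proof. exact: leq_ltn_trans (leq0n _) dom. Qed.
Let a00 : (0 < a 0)%N. Proof. by rewrite lt0n; apply: contraNneq pa0 => ->; rewrite dvdn0. Qed.
Let sP : size P = d.+1. Proof. exact: size_poly_lead. Qed.
Let lP : lead_coef P = a d. Proof. by rewrite lead_coefE sP coef_poly ltnSn. Qed.
Let P0 : P`_0 = a 0. Proof. by rewrite coef_poly. Qed.

Lemma eisenstein_alg_degree : alg_degree alpha d.
Proof.
apply: irreducible_alg_degree sP Pa; apply: (eisenstein_crit pp).
- by rewrite sP; case: (d) d0.
- by rewrite lP.
- by rewrite P0.
by rewrite sP => i id; rewrite coef_poly ltnS (ltnW id) dvdzE pa.
Qed.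

Lemma eisenstein_neq0 : alpha != 0.
Proof.
apply: contraTneq Pa => ->; rewrite /root horner_coef0 coef_map_id0// P0.
by rewrite intr_eq0 -lt0n.
Qed.

Lemma eisenstein_setA_disk : setA d d (powR (a d)%:R d%:R^-1) alpha.
Proof.
have deg := eisenstein_alg_degree; split=> //.
have mP : minpolyZ P alpha.
  by apply: minpolyZ_primitive deg _ _ Pa _ => //; rewrite lP ?P0.
have [rs cP] := conjugates_exist d0 mP deg.
have h : all (fun z => cabs z < 1) rs.
  by apply/allP => z /cP.2; exact: dominant_lead_disk.
exists P, rs; do 3!split=> //; first by rewrite weil_height_mahler mahler_disk// lP.
by move: h; rewrite all_count (size_conjugates d0 mP deg cP) => /eqP.
Qed.

(** Reversal swaps the end coefficients, and their coprimality is symmetric. The new roots are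
    inverses of points of the disk, and the new constant coefficient [a d] gives the same height as
    in the disk case. *)
Lemma eisenstein_setA_codisk : setA 0 d (powR (a d)%:R d%:R^-1) alpha^-1.
Proof.
have an0 := eisenstein_neq0.
have deg := alg_degreeV d0 an0 eisenstein_alg_degree; split=> //.
pose Q := \poly_(i < d.+1) (a (d - i)%N)%:Z.
have QE : Q = revpoly d P by rewrite revpoly_poly.
have sQ : size Q = d.+1 by rewrite (@size_poly_lead (fun i => a (d - i)%N))// subnn.
have lQ : lead_coef Q = a 0 by rewrite lead_coefE sQ coef_poly ltnSn subnn.
have Q0 : Q`_0 = a d by rewrite coef_poly subn0.
have szP : (size (polyZC R P) <= d.+1)%N.
  by rewrite -map_ratr_pZtoQ size_map_poly size_rat_int_poly sP.
have Qroot z : z != 0 -> root (polyZC R Q) z = root (polyZC R P) z^-1.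
  by move=> z0; rewrite QE /polyZC map_revpoly root_revpoly.
have mQ : minpolyZ Q alpha^-1.
  apply: minpolyZ_primitive deg _ _ _ _ => //; first by rewrite lQ.
    by rewrite Qroot ?invr_eq0 ?invrK.
  by rewrite lQ Q0 /coprimez gcdzC.
have [rs cQ] := conjugates_exist d0 mQ deg.
have h z : z \in rs -> 1 < cabs z.
  move=> /cQ.2 Qz; have z0 : z != 0.
    apply: contraTneq Qz => ->; rewrite /root horner_coef0 coef_map_id0// Q0.
    by rewrite intr_eq0 -lt0n.
  rewrite Qroot// in Qz; have := dominant_lead_disk d0 dom Qz.
  rewrite /cabs ComplexField.Normc.normcV -/(cabs z) invf_lt1//.
  rewrite lt_neqAle cabs_ge0 andbT eq_sym; apply: contra z0 => /eqP cz.
  by rewrite -normr_eq0 normC_cabs cz.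
exists Q, rs; do 3!split=> //.
  rewrite weil_height_mahler (mahler_codisk _ (conjugates_prod d0 mQ deg cQ)) ?lQ//.
    by rewrite Q0.
  by apply/allP => z /h/ltW.
apply/eqP; rewrite eqn0Ngt -has_count; apply/hasPn => z /h z1.
by rewrite -leNgt ltW.
Qed.

End Eisenstein.

(** The difference has degree below [d] and vanishes at [alpha]. This makes the choice of one root
    per polynomial injective. *)
Lemma same_root_poly_eq a b d alpha : alg_degree alpha d -> a d = b d ->
  root (polyZC R (\poly_(i < d.+1) (a i)%:Z)) alpha ->
  root (polyZC R (\poly_(i < d.+1) (b i)%:Z)) alpha ->
  forall i, (i < d)%N -> a i = b i.
Proof.
move=> [_ min] abd ra rb i id.
pose D := \poly_(i < d) ((a i)%:Z - (b i)%:Z).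
have DE : D = \poly_(i < d.+1) (a i)%:Z - \poly_(i < d.+1) (b i)%:Z.
  apply/polyP => j; rewrite coefB !coef_poly ltnS (leq_eqVlt j d).
  by case: (ltngtP j d) => [_|_|->] /=; rewrite ?abd ?subrr.
have [D0|D0] := eqVneq D 0.
  have := congr1 (fun p : {poly int} => p`_i) D0.
  by rewrite coef_poly id coef0 => /eqP; rewrite subr_eq0 => /eqP[].
have := min (map_poly intr D); rewrite map_ratr_pZtoQ size_rat_int_poly.
rewrite -size_poly_eq0 size_rat_int_poly size_poly_eq0 => /(_ D0).
rewrite ltnNge size_poly => h; suff /h : root (polyZC R D) alpha by [].
rewrite DE /polyZC rmorphB /= /root hornerD hornerN.
by rewrite (rootP ra) (rootP rb) subrr.
Qed.

(** One root is picked from each polynomial of the family; the constant coefficient is indexed by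
    good primes, the next [d - 1] by the integers up to [X]. *)
Lemma setA_lower k d n L : (0 < d)%N -> (k = 0 \/ k = d)%N -> (d <= L)%N ->
  (32 <= L)%N -> (2 ^ L.-1 <= n)%N -> (n < 2 ^ L)%N ->
  (n ^ d <= (8 * d * L ^ 3) ^ d * ncard (setA k d (powR (n%:R : R) d%:R^-1)))%N.
Proof.
move=> d0 hk dL L32 nL1 nL.
have n0 : (0 < n)%N by rewrite (leq_trans _ nL1) ?expn_gt0.
have [|p [pp pn pL]] := @small_nondivisor_prime L n _ n0 nL.
  by rewrite (leq_trans _ L32).
have [] := many_good_primes d0 dL L32 nL1 nL (prime_gt0 pp) pL.
set X := (_ %/ _)%N; set K := (8 * d * L ^ 3)%N; set G := good_primes n p X.
move=> hX hG; have dpX : (d * p * X < n)%N.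
  by have := leq_divM n.-1 (d * p); rewrite mulnC -/X; lia.
case: d => // e in d0 hk dL X K G hX hG dpX *.
(* Members of [D] hold the non-leading coefficients divided by [p]; only the constant one is
   restricted. *)
pose D := family (fun i : 'I_e.+1 => [pred u : 'I_X.+1 | (i == ord0) ==> (val u \in G)]).
have cD : (n ^ e.+1 <= K ^ e.+1 * #|D|)%N.
  rewrite card_family foldrE big_map big_enum /= big_ord_recl.
  rewrite [(n ^ _)%N]expnS [(K ^ _)%N]expnS mulnACA; apply: leq_mul.
    apply: leq_trans hG _; rewrite leq_mul2l; apply/orP; right.
    rewrite cardE -(size_map val); apply: uniq_leq_size.
      exact/filter_uniq/uniq_primes_upto.
    move=> u uG; have : (u <= X)%N by move: uG; rewrite mem_good_primes// => /and4P[].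
    rewrite -ltnS => uX; apply/mapP; exists (Ordinal uX) => //.
    by rewrite mem_enum unfold_in /= uG.
  rewrite (eq_bigr (fun=> X.+1)); last first.
    by move=> i _; rewrite -[RHS]card_ord; apply: eq_card.
  rewrite prod_nat_const card_ord -expnMn.
  by case: (e) => // e'; rewrite leq_exp2r.
apply: leq_trans cD _; rewrite leq_mul2l; apply/orP; right.
pose a (f : {ffun 'I_e.+1 -> 'I_X.+1}) i := if (i < e.+1)%N then (p * f (inord i))%N else n.
have aE f : a f e.+1 = n by rewrite /a ltnn.
have aI f i : (i < e.+1)%N -> a f i = (p * f (inord i))%N by rewrite /a => ->.
have domf f : (\sum_(i < e.+1) a f i < a f e.+1)%N.
  rewrite aE; apply: leq_ltn_trans dpX; rewrite -mulnA -[X in (_ <= X * _)%N]card_ord.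
  rewrite -sum_nat_const; apply: leq_sum => i _.
  by rewrite aI// leq_mul2l -ltnS ltn_ord orbT.
have aD f : f \in D -> [/\ ~~ (p %| a f e.+1)%N, ~~ (p ^ 2 %| a f 0)%N &
    coprime (a f 0) (a f e.+1)].
  move=> /familyP/(_ ord0); rewrite inE /= => fG.
  rewrite aE aI// (_ : inord 0 = ord0); last by apply: val_inj; rewrite /= inordK.
  move: fG; rewrite mem_good_primes// => /and4P[up _ upn un]; split=> //.
    rewrite expnS expn1 dvdn_pmul2l ?prime_gt0// dvdn_prime2// eq_sym.
    exact: upn.
  by rewrite coprimeMl !prime_coprime// pn.
have paf f i : (i < e.+1)%N -> (p %| a f i)%N by move=> /aI ->; exact: dvdn_mulr.
pose P f := \poly_(i < e.+2) (a f i)%:Z.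
have ex f : exists z : C, root (polyZC R (P f)) z.
  apply/closed_rootP; rewrite -map_ratr_pZtoQ size_map_poly size_rat_int_poly.
  by rewrite size_poly_lead// aE.
have [r rP] := choice ex.
have inj : {in D &, injective r}.
  move=> f g fD gD rfg; have [h1 h2 h3] := aD f fD.
  have deg := eisenstein_alg_degree d0 pp h1 (paf f) h2 (domf f) (rP f).
  apply/ffunP => i; apply: val_inj.
  have := @same_root_poly_eq (a f) (a g) _ _ deg _ (rP f) _ i (ltn_ord i).
  rewrite rfg !aE => /(_ erefl (rP g)); rewrite !aI// inord_val => /eqP.
  by rewrite eqn_pmul2l ?prime_gt0// => /eqP.
have Hd : powR (n%:R : R) e.+1%:R^-1 ^+ e.+1 = n%:R by rewrite powR_exprn.
have [fA _] := setA_upper d0 hk Hd.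
case: hk => hk; rewrite hk in fA *.
  apply: (@ncard_ge_inj _ _ _ _ (fun f => (r f)^-1)) => //.
    by move=> f g fD gD /invr_inj; exact: inj.
  move=> f fD; have [h1 h2 h3] := aD f fD.
  by rewrite -(aE f); apply: (eisenstein_setA_codisk d0 pp h1 (paf f) h2 h3 (domf f) (rP f)).
apply: (@ncard_ge_inj _ _ _ _ r) => // f fD; have [h1 h2 h3] := aD f fD.
by rewrite -(aE f); apply: (eisenstein_setA_disk d0 pp h1 (paf f) h2 h3 (domf f) (rP f)).
Qed.

End Lower.

(** * Limits *)

Section Limits.
Variable R : realType.

(** From this [n] on, the bit length of [n] exceeds both 32 and [d], as the lower bound requires. *)
Definition start_size d := (2 ^ maxn 32 d)%N.

Lemma setA_lower_trunc_log k d n : (0 < d)%N -> (k = 0 \/ k = d)%N ->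
  (start_size d <= n)%N -> let L := (trunc_log 2 n).+1 in
  (2 ^ L.-1 <= n)%N /\
  (n ^ d <= (8 * d * L ^ 3) ^ d * ncard (setA k d (powR (n%:R : R) d%:R^-1)))%N.
Proof.
move=> d0 hk n0 L; have npos : (0 < n)%N by rewrite (leq_trans _ n0) ?expn_gt0.
have /andP[h1 h2] := trunc_log_bounds (ltnSn 1) npos.
have : (maxn 32 d < L)%N by rewrite ltnS trunc_log_max.
rewrite gtn_max => /andP[/ltnW h3 /ltnW h4].
by split=> //; exact: setA_lower.
Qed.

Lemma setB_start k d n : (0 < d)%N -> (k = 0 \/ k = d)%N ->
  (start_size d <= n)%N -> setB k d (powR (n%:R : R) d%:R^-1).
Proof.
move=> d0 hk n0; have npos : (0 < n)%N by rewrite (leq_trans _ n0) ?expn_gt0.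
split.
  apply: le_trans (_ : powR (1 : R) d%:R^-1 <= _); first by rewrite powR1.
  by apply: ge0_ler_powR; rewrite ?nnegrE ?invr_ge0// ler1n.
have [_] := setA_lower_trunc_log d0 hk n0.
(* If no point had this height, the lower bound would read [n ^ d <= 0]. *)
have [[alpha Aa] _|A0] := pselect (exists alpha, setA k d (powR (n%:R : R) d%:R^-1) alpha).
  by exists alpha.
rewrite (_ : setA _ _ _ = set0); last by apply/seteqP; split=> // x Ax; case: A0; exists x.
by rewrite /ncard fset_set0 finmap.cardfs0 muln0 leqn0 expn_eq0 (gtn_eqF npos).
Qed.

Lemma ln_leB (x y : R) : 0 < x -> x <= y -> ln x <= ln y.
Proof. by move=> x0 xy; rewrite ler_ln ?posrE// (lt_le_trans x0). Qed.

(** This follows from [ln y <= y - 1] at [y = delta * x]. Applied to the bit length [L], it makes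
    [ln L] negligible against [ln n] with explicit constants. *)
Lemma ln_le_linear (delta x : R) : 0 < delta -> 0 < x -> ln x <= delta * x - ln delta.
Proof.
move=> d0 x0; rewrite lerBrDl -lnM ?posrE//.
rewrite -[X in ln X](addrNK 1) addrC; apply: le_trans (le_ln1Dx _) _.
  by rewrite ltrBrDl addrN mulr_gt0.
by rewrite gerBl.
Qed.

(** Here [a] is the logarithm of a count and [t] that of the height. The constant [c] uses half of
    the tolerance; the other half, granted to the lower bound, absorbs the [ln L] term. *)
Lemma ratio_close (D a t c e : R) : 0 < t -> 2 * c <= e * t ->
  a <= D * t + c -> D * t <= a + e / 2 * t + c -> 0 <= c -> `|D - a / t| <= e.
Proof.
move=> t0 ct h1 h2 c0; have -> : D - a / t = (D * t - a) / t.
  by rewrite mulrBl mulfK// gt_eqF.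
rewrite normrM normfV (gtr0_norm t0) ler_pdivrMr// ler_norml.
by apply/andP; split; nra.
Qed.

Lemma ln_large (T : R) : exists M : R, forall x, M < x -> 1 < x /\ T < ln x.
Proof.
exists (expR (Num.max 0 T)) => x hx; have x0 := lt_trans (expR_gt0 _) hx.
have : Num.max 0 T < ln x by rewrite -(@ltr_expR R) lnK.
rewrite gt_max => /andP[l0 ->]; split=> //.
by rewrite ltNge; apply/negP => /ln_le0; rewrite leNgt l0.
Qed.

Lemma setA_ratio_close k d (e : R) : (0 < d)%N -> (k = 0 \/ k = d)%N -> 0 < e ->
  exists M : R, forall Hh, setB k d Hh -> M < Hh ->
    `|(d ^ 2)%:R - ln (ncard (setA k d Hh))%:R / ln Hh| <= e.
Proof.
move=> d0 hk e0; have d0R : 0 < d%:R :> R by rewrite ltr0n.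
have ln2 : 0 < ln (2 : R) by rewrite ln_gt0 ?ltr1n.
(* Chosen so that [3 d * delta * (d t / ln 2)] equals [e / 2 * t]. *)
pose delta := e * ln 2 / (6 * d%:R ^+ 2) : R.
have de0 : 0 < delta by rewrite divr_gt0 ?mulr_gt0 ?exprn_gt0.
(* [c1] is the logarithm of the constant in the upper bound, once [2 (2^d n) + 1] is bounded by
   [2^(d+2) n]. [c2] collects the constants left from [(8 d L^3)^d] after [ln L] is linearised. *)
pose c1 : R := ln (d * (2 * (2 ^ (d + 2)) ^ d))%:R.
pose c2 : R := d%:R * ln (8 * d)%:R + 3 * d%:R * (delta - ln delta).
pose c : R := `|c1| + `|c2|.
have [M0 hM0] := ln_large (2 * c / e).
exists (Num.max M0 (start_size d)%:R) => Hh BH; rewrite gt_max => /andP[/hM0[H1 Hc] Hs].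
have [n Hn] := setB_nat d0 hk BH.
have H0 : 0 < Hh := lt_trans ltr01 H1.
have HE : Hh = powR n%:R d%:R^-1 by rewrite -Hn exprn_powR// ltW.
have sn : (start_size d <= n)%N.
  rewrite -(ler_nat R) -Hn; apply: le_trans (ltW Hs) _.
  by rewrite -[leLHS]expr1 ler_weXn2l// ltW.
have npos : (0 < n)%N by rewrite (leq_trans _ sn) ?expn_gt0.
have nR : 0 < n%:R :> R by rewrite ltr0n.
have [h1 h2] := setA_lower_trunc_log d0 hk sn; move: h1 h2; set L := (trunc_log _ _).+1 => h1.
rewrite -HE => h2; have [_ h3] := setA_upper d0 hk Hn.
set N := ncard _ in h2 h3 *.
have Npos : (0 < N)%N.
  by rewrite lt0n; apply: contraTneq h2 => ->; rewrite muln0 leqn0 expn_eq0 gtn_eqF.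
set t := ln Hh; have t0 : 0 < t by rewrite ln_gt0.
have lnn : ln n%:R = d%:R * t :> R by rewrite -Hn lnXn// mulr_natl.
have LR : 0 < L%:R :> R by rewrite ltr0n.
apply: (@ratio_close _ _ _ c) => //.
- by move: Hc; rewrite ltr_pdivrMr// (mulrC _ e) => /ltW.
- have : (N <= d * (2 * (2 ^ (d + 2)) ^ d) * n ^ d)%N.
    apply: leq_trans h3 _; rewrite -!mulnA leq_mul2l; apply/orP; right.
    rewrite leq_mul2l /= -expnMn leq_exp2r// expnD.
    have lt4 q : (0 < q -> 2 * q < q * 4)%N by clear; lia.
    by rewrite mulnAC lt4// muln_gt0 expn_gt0.
  rewrite -(ler_nat R) => /ln_leB; rewrite ltr0n => /(_ Npos) /le_trans; apply.
  rewrite natrM lnM ?posrE ?ltr0n ?muln_gt0 ?expn_gt0 ?d0 ?npos// -/c1.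
  rewrite natrX lnXn// lnn addrC -[(_ * t) *+ d]mulr_natl natrX expr2 mulrA lerD2l.
  by rewrite /c (le_trans (ler_norm _))// lerDl.
- move: h2; rewrite -(ler_nat R) => /ln_leB; rewrite ltr0n expn_gt0 npos => /(_ isT).
  have Kpos : 0 < (8 * d * L ^ 3)%:R :> R by rewrite ltr0n !muln_gt0 d0.
  rewrite natrM !natrX lnXn// lnn lnM ?posrE ?ltr0n ?exprn_gt0// lnXn//.
  rewrite natrM lnM ?posrE ?ltr0n ?muln_gt0 ?d0 ?expn_gt0// natrX lnXn//.
  rewrite -[(_ * t) *+ d]mulr_natl -[(ln L%:R) *+ 3]mulr_natl.
  rewrite -[(_ + _) *+ d]mulr_natl => h4.
  have h5 := ln_le_linear de0 LR.
  (* [L - 1] is the integer part of the binary logarithm of [n], and [ln n = d t]. *)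
  have h6 : L%:R <= 1 + d%:R * t / ln 2.
    rewrite -lerBlDl ler_pdivlMr// -lnn.
    have := ln_leB _ (_ : ((2 ^ L.-1)%:R : R) <= n%:R).
    rewrite ltr0n expn_gt0 ler_nat => /(_ isT h1); rewrite natrX lnXn// -[(ln 2) *+ _]mulr_natl.
    by rewrite /L -(natr1 (trunc_log 2 n)) addrK.
  have h7 : 3 * d%:R * ln L%:R <= 3 * d%:R * (delta - ln delta) + e / 2 * t.
    have -> : 3 * d%:R * (delta - ln delta) + e / 2 * t =
        3 * d%:R * (delta * (1 + d%:R * t / ln 2) - ln delta).
      by rewrite /delta; field; rewrite !gt_eqF.
    rewrite ler_pM2l ?mulr_gt0//; apply: le_trans h5 _.
    by rewrite lerD2r ler_pM2l.
  have h8 : c2 <= c by rewrite /c (le_trans (ler_norm _))// lerDr.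
  move: h4 h8; rewrite /c2 expr2; set x := ln _; set y := ln _; set z := ln _.
  by move: h7; rewrite -/y => h7 h4 h8; lra.
by rewrite addr_ge0.
Qed.

(** * Counting the heights themselves *)

Lemma setBH_upper k d (x : R) : (0 < d)%N -> (k = 0 \/ k = d)%N -> 0 <= x ->
  finite_set (setBH k d x) /\ ((ncard (setBH k d x))%:R <= x ^+ d :> R).
Proof.
move=> d0 hk x0; pose N := Num.truncn (x ^+ d).
have /andP[N1 N2] : N%:R <= x ^+ d < N.+1%:R by rewrite truncn_itv// exprn_ge0.
have [|fB cB] := @ncard_le_seq _ (setBH k d x) [seq powR m%:R d%:R^-1 | m <- iota 1 N].
  move=> y [yB] /= /andP[y1 yx]; have [n yn] := setB_nat d0 hk yB.
  have y0 : 0 <= y := le_trans ler01 y1.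
  apply/mapP; exists n; last by rewrite -yn exprn_powR.
  rewrite mem_iota add1n; apply/andP; split.
    by rewrite -(ltr0n R) -yn exprn_gt0// (lt_le_trans ltr01).
  by rewrite -(ltr_nat R) -yn; apply: le_lt_trans N2; rewrite lerXn2r.
split=> //; apply: le_trans N1; rewrite ler_nat.
by rewrite (leq_trans cB)// size_map size_iota.
Qed.

(** Every integer above [start_size d] and up to [x ^ d] has its [d]-th root in the set; the two
    extra summands pay for the skipped integers and for truncating [x ^ d]. *)
Lemma setBH_lower k d (x : R) : (0 < d)%N -> (k = 0 \/ k = d)%N -> 0 <= x ->
  x ^+ d <= (ncard (setBH k d x) + start_size d)%:R + 1.
Proof.
move=> d0 hk x0; pose N := Num.truncn (x ^+ d).
have /andP[N1 N2] : N%:R <= x ^+ d < N.+1%:R by rewrite truncn_itv// exprn_ge0.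
apply: le_trans (ltW N2) _; rewrite natr1 ler_nat ltnS addnC -leq_subLR.
have [fB _] := setBH_upper d0 hk x0.
rewrite -[leqLHS]card_ord.
apply: (@ncard_ge_inj _ _ _ _ (fun i : 'I_(N - start_size d) =>
  powR (start_size d + i).+1%:R d%:R^-1)) => //.
  move=> i j _ _ /powR_injective; rewrite invr_gt0 ltr0n d0 !nnegrE => /(_ isT).
  by move=> /(_ (ler0n _ _) (ler0n _ _))/(mulrIn (oner_neq0 _)) [] /addnI/val_inj.
move=> i _; have iN : ((start_size d + i).+1 <= N)%N by have := ltn_ord i; lia.
have B : setB k d (powR ((start_size d + i).+1%:R : R) d%:R^-1).
  by apply: setB_start => //; lia.
split=> //=; rewrite B.1 /= -(exprn_powR d0 x0).
apply: ge0_ler_powR; rewrite ?invr_ge0 ?nnegrE ?exprn_ge0//.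
by apply: le_trans N1; rewrite ler_nat.
Qed.

Lemma setBH_ratio_close k d (e : R) : (0 < d)%N -> (k = 0 \/ k = d)%N -> 0 < e ->
  exists M : R, forall Hh, M < Hh ->
    `|d%:R - ln (ncard (setBH k d Hh))%:R / ln Hh| <= e.
Proof.
move=> d0 hk e0; pose c := ln (2 : R).
have [M0 hM0] := ln_large (2 * c / e).
exists (Num.max M0 (2 * (start_size d).+1%:R)) => x; rewrite gt_max => /andP[/hM0[x1 xc] xs].
have x0 : 0 < x := lt_trans ltr01 x1.
have xd : x <= x ^+ d by rewrite -[leLHS]expr1 ler_weXn2l// ltW.
have [_ h1] := setBH_upper d0 hk (ltW x0).
have := setBH_lower d0 hk (ltW x0).
set N := ncard _ in h1 *; rewrite natrD => h2.
(* Since [2 (start_size d + 1) < x <= x ^ d], the loss is at most half of [x ^ d]; hence the error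
   constant [ln 2]. *)
have h3 : x ^+ d <= 2 * N%:R.
  by move: xs; rewrite -natr1 => xs; lra.
have Npos : 0 < N%:R :> R.
  by have := exprn_gt0 d x0; lra.
have t0 : 0 < ln x by rewrite ln_gt0.
have lnx : ln (x ^+ d) = d%:R * ln x by rewrite lnXn// mulr_natl.
have c0 : 0 <= c by rewrite ln_ge0// ler1n.
apply: (@ratio_close _ _ _ c) => //.
- by move: xc; rewrite ltr_pdivrMr// (mulrC _ e) => /ltW.
- by rewrite -lnx (le_trans (ln_leB Npos h1))// lerDl.
- have := ln_leB (exprn_gt0 d x0) h3; rewrite lnx lnM ?posrE// -/c => h4.
  have : 0 <= e / 2 * ln x by rewrite mulr_ge0 ?divr_ge0 ?ltW.
  by lra.
Qed.

End Limits.

Theorem theorem2p1 (R : realType) (d k : nat) :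
  (0 < d)%N -> (k = 0 \/ k = d)%N ->
  ((ln (ncard (setBH k d Hh))%:R / ln Hh) @[Hh --> +oo] --> (d%:R : R)) /\
  (forall M : R, exists2 Hh : R, setB k d Hh & M < Hh) /\
  ((ln (ncard (setA k d Hh))%:R / ln Hh) @[Hh --> within (setB k d) +oo]
      --> ((d ^ 2)%:R : R)).
Proof.
move=> d0 hk; split; [|split].
- apply/cvgrPdist_le => e e0; have [M hM] := setBH_ratio_close d0 hk e0.
  by exists M; split; [exact: num_real | exact: hM].
(* Unboundedness of [setB k d] keeps the limit along it from being vacuous. The witness is the
   [d]-th root of an integer beyond both [start_size d] and [|M| ^ d]. *)
- move=> M; pose n := (start_size d + (Num.truncn (`|M| ^+ d)).+1)%N.
  exists (powR n%:R d%:R^-1); first by apply: setB_start => //; exact: leq_addr.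
  apply: le_lt_trans (ler_norm M) _.
  rewrite -(ltr_pXn2r d0) ?nnegrE ?powR_ge0// powR_exprn//.
  have /andP[_ h] := truncn_itv (exprn_ge0 d (normr_ge0 M)).
  by apply: lt_le_trans h _; rewrite ler_nat leq_addl.
apply/cvgrPdist_le => e e0; have [M hM] := setA_ratio_close d0 hk e0.
by exists M; split; [exact: num_real | move=> x Mx Bx; exact: hM].
Qed.
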